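(* Let $p$ be a prime, let $\mathbb{F}$ be a field of characteristic $p$, and let $A$ be either $\mathbb{F}[x]/(x^p-1)$ or $\mathbb{F}[x]/(x^p)$, with $\partial: A\to A$ the derivation induced by $\frac{d}{dx}$. Then there is a function $C: A\to\mathbb{F}$ such that for every $f\in A$: (a) $(f\partial)^{[p]}=C(f)\,f\partial$ in $W=\operatorname{Der}A$; (b) the element $\partial(f\,\partial(f\,\partial(\cdots(f\,\partial f)\cdots)))$ of $A$, formed with $p-1$ letters $\partial$ and $p-1$ letters $f$, is a constant, and this constant equals $C(f)$; (c) the element $\partial^{p-1}(f^{p-1})$ of $A$ is a constant, and this constant equals $-C(f)$.
   Context: The ideals $(x^p-1)$ and $(x^p)$ of $\mathbb{F}[x]$ are stable under $\frac{d}{dx}$ (since $\operatorname{char}\mathbb{F}=p$), so $\frac{d}{dx}$ induces an $\mathbb{F}$-linear derivation $\partial$ of $A$. The Witt algebra is $W=\operatorname{Der}A$, the Lie algebra of $\mathbb{F}$-linear derivations of $A$; its elements are exactly the ''vector fields'' $f\partial$ with $f\in A$, where $(f\partial)(g)=f\cdot\partial g$. It has a canonical restricted Lie algebra structure in which $g^{[p]}=g^p=g\circ\cdots\circ g$ ($p$-fold composition of the operator $g: A\to A$), which is again a derivation of $A$. A ''constant'' is an element of $\mathbb{F}\subset A$. In (b), the expression is obtained by starting with $f$, applying $\partial$, then alternately multiplying by $f$ and applying $\partial$, until $\partial$ has been applied $p-1$ times and $f$ has been used $p-1$ times; for example, it is $\partial f$ for $p=2$ and $\partial(f\,\partial f)$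 for $p=3$. *)

(* Defs.v *)
From HB Require Import structures.
From mathcomp Require Import all_boot all_order all_algebra.
From mathcomp Require Import boolp.

Set Implicit Arguments.
Unset Strict Implicit.
Unset Printing Implicit Defensive.

Import GRing.Theory.
Local Open Scope ring_scope.

Section Derivations.

Variables (F : fieldType) (h : {poly F}).
Local Notation A := {poly %/ h}.

Definition derivation : {pred 'End(A)} :=
  fun D => `[< forall u v : A, D (u * v) = D u * v + u * D v >].

Lemma derivationP (D : 'End(A)) :
  reflect (forall u v : A, D (u * v) = D u * v + u * D v) (D \in derivation).
Proof. exact: asboolP. Qed.

Fact derivation_submod_closed : submod_closed derivation.
Proof.
split=> [|a D E /derivationP derD /derivationP derE]; apply/derivationP=> u v.
  by rewrite !zero_lfunE mul0r mulr0 addr0.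
rewrite !(add_lfunE, scale_lfunE) derD derE scalerDr mulrDl mulrDr.
by rewrite -scalerAl -scalerAr addrACA.
Qed.

HB.instance Definition _ :=
  GRing.isSubmodClosed.Build F 'End(A) derivation derivation_submod_closed.

Record Der : predArgType :=
  MkDer { Der_val :> 'End(A); _ : Der_val \in derivation }.

HB.instance Definition _ := [isSub for Der_val].
HB.instance Definition _ := [Choice of Der by <:].
HB.instance Definition _ := [SubChoice_isSubLmodule of Der by <:].

Lemma Der_mul (D : Der) (u v : A) : D (u * v) = D u * v + u * D v.
Proof. by have /derivationP := valP D. Qed.

Fact vfield_subproof (f : A) (D : Der) : linfun (f \*o D) \in derivation.
Proof.
apply/derivationP=> u v; rewrite !lfunE /= Der_mul mulrDr mulrA.
by rewrite [u * (f * _)]mulrCA.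
Qed.

Definition vfield (f : A) (D : Der) : Der := MkDer (vfield_subproof f D).

Lemma vfieldE (f : A) (D : Der) (g : A) : vfield f D g = f * D g.
Proof. exact: lfunE. Qed.

Definition lfun_iter (n : nat) (D : 'End(A)) : 'End(A) :=
  iter n (fun E => D \o E)%VF \1%VF.

Lemma lfun_iterE n (D : 'End(A)) (g : A) : lfun_iter n D g = iter n D g.
Proof. by elim: n => [|n IHn]; rewrite /= ?id_lfunE // comp_lfunE /= IHn. Qed.

Lemma Der_iterM n (D : Der) (u v : A) :
  iter n D (u * v) =
    \sum_(i < n.+1) (iter (n - i) D u * iter i D v) *+ 'C(n, i).
Proof.
elim: n => [|n IHn]; first by rewrite big_ord1.
rewrite iterS IHn linear_sum.
under eq_bigr do rewrite linearMn /= Der_mul mulrnDl.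
rewrite big_split /= big_ord_recl [in RHS]big_ord_recl /= !bin0 !subn0.
rewrite -addrA; congr (_ + _).
under [in RHS]eq_bigr do rewrite /= binS mulrnDr subSS.
rewrite big_split /=; congr (_ + _).
rewrite [RHS]big_ord_recr /= bin_small ?mulr0n ?addr0 //.
apply: eq_bigr => i _ /=; rewrite /bump /= add1n.
by rewrite -iterS -subSn ?subSS // ltnW.
Qed.

Variable (p : nat) (charF : p \in [pchar F]).

Fact Der_pmap_subproof (D : Der) : lfun_iter p D \in derivation.
Proof.
have p_gt0 := prime_gt0 (pcharf_prime charF).
have charA : p \in [pchar A] by rewrite pchar_qpoly.
apply/derivationP=> u v; rewrite !lfun_iterE Der_iterM.
case: p charF p_gt0 charA => // q charq _ charA.
rewrite big_ord_recl big_ord_recr /= bin0 binn /bump /= add1n subnn.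
rewrite big1 ?add0r // => i _.
have /dvdnP[m ->] : (q.+1 %| 'C(q.+1, 1 + i))%N.
  by rewrite prime_dvd_bin ?(pcharf_prime charq) //= add1n ltnS ltn_ord.
by rewrite mulrnA -mulr_natr (pcharf0 charA) mulr0.
Qed.

(* The p-map D |-> D^[p] of the restricted Lie algebra Der A. *)
Definition Der_pmap (D : Der) : Der := MkDer (Der_pmap_subproof D).

Lemma Der_pmapE (D : Der) (g : A) : Der_pmap D g = iter p D g.
Proof. exact: lfun_iterE. Qed.

End Derivations.

Section DerX.

Variables (p : nat) (F : fieldType) (charF : p \in [pchar F]).
Variables (h : {poly F}) (hE : h = 'X^p - 1 \/ h = 'X^p).
Local Notation A := {poly %/ h}.

(* [{poly %/ h}] is F[X]/(mk_monic h), where [mk_monic h] is a default value  *)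
(* unless h is monic and nonconstant; here it is h.                           *)
Lemma mk_monic_modulus : mk_monic h = h.
Proof.
have p_gt1 := prime_gt1 (pcharf_prime charF); have p_gt0 := ltnW p_gt1.
rewrite /mk_monic ifT //; case: hE => ->.
  by rewrite -polyC1 size_XnsubC // monicXnsubC // ltnS p_gt0.
by rewrite size_polyXn monicXn ltnS p_gt0.
Qed.

Lemma deriv_modulus : h^`() = 0.
Proof.
have Xp0 : ('X^p : {poly F})^`() = 0.
  by rewrite derivXn -mulr_natr -polyC_natr (pcharf0 charF) polyC0 mulr0.
by case: hE => ->; rewrite ?derivB ?Xp0 // -polyC1 derivC subr0.
Qed.

(* Differentiates the representative of degree < p; [qderiv_in_qpoly] shows   *)
(* that any representative may be used.                                       *)
Definition qderiv (g : A) : A := in_qpoly h (g : {poly F})^`().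

Fact qderiv_is_linear : linear qderiv.
Proof.
move=> a u v; rewrite /qderiv -in_qpolyZ -in_qpolyD.
by congr in_qpoly; rewrite /= linearP.
Qed.

HB.instance Definition _ :=
  GRing.isLinear.Build F A A *:%R qderiv qderiv_is_linear.

Lemma qderiv_in_qpoly (q : {poly F}) : qderiv (in_qpoly h q) = in_qpoly h q^`().
Proof.
have hM := monic_mk_monic h; rewrite mk_monic_modulus in hM.
apply: val_inj; rewrite /= mk_monic_modulus.
rewrite [q in RHS](Pdiv.RingMonic.rdivp_eq hM q) derivD derivM deriv_modulus.
by rewrite mulr0 addr0 Pdiv.RingMonic.rmodpD // Pdiv.RingMonic.rmodp_mull ?add0r.
Qed.

Fact ddx_subproof : linfun qderiv \in derivation (h := h).
Proof.
have qK (g : A) : g = in_qpoly h (g : {poly F}).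
  by apply: val_inj; exact/esym/in_qpoly_small/size_mk_monic.
apply/derivationP=> u v; rewrite !lfunE /= {1}[u]qK {1}[v]qK -in_qpolyM.
by rewrite qderiv_in_qpoly derivM in_qpolyD !in_qpolyM -!qK.
Qed.

Definition ddx : Der h := MkDer ddx_subproof.

Lemma ddxE (q : {poly F}) : ddx (in_qpoly h q) = in_qpoly h q^`().
Proof. by rewrite lfunE /= qderiv_in_qpoly. Qed.

End DerX.

(* Main.v *)
Require Import Defs.
From mathcomp Require Import all_boot all_order all_algebra.
Import GRing.Theory.
Local Open Scope ring_scope.

(** The idea is to prove everything in the domain F[x], where f can be
    cancelled, and then to reduce modulo h; in A itself f is in general a zero
    divisor.

    Let ' be d/dx on F[x], let D = f d/dx, and let E be the polynomial of (b),
    so that D^p x = D^(p-1) f = f E. In characteristic p the operator D^p is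
    again a derivation, and a derivation of F[x] is determined by its value at
    x; hence D^p g = f E g' for all g [iter_vf_pchar]. Computing D^(p+1) x both
    as D^p (D x) and as D (D^p x) gives f E f' = f (f E)', that is, f^2 E' = 0,
    and so E' = 0 when f is nonzero; E = 0 otherwise [deriv_iter_alt].

    For (c), the relation D (D^(p-1) g - E g) = 0 shows, f being cancelled, that
    the differential operator D^(p-1) - E takes values in the kernel of d/dx.
    Expand it as the sum of the b_i (d/dx)^i over i < p: here
    b_(p-1) = f^(p-1), and b_0 = - E because D^(p-1) has no term of order 0
    [vfcoefS0]. Composing with d/dx on the left must give 0, and the operators
    (d/dx)^i with i < p are linearly independent over F[x]
    [diffop_eq0], so that b_(i-1) = - b_i' for 0 < i < p. Following this recursion
    down from i = p-1 gives - E = (d/dx)^(p-1) (f^(p-1)) [derivn_exp_alt].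

    Finally E' = 0 makes the class of E in A a constant, because an element of A
    is represented by a polynomial of degree < p, and no exponent strictly
    between 0 and p vanishes in F [ddx_eq0_const]. *)

(** * Iterates of derivations *)

Lemma iter_leibniz (S : comPzRingType) (D : {additive S -> S}) :
    (forall u v, D (u * v) = D u * v + u * D v) ->
  forall n u v,
    iter n D (u * v) =
      \sum_(i < n.+1) (iter (n - i) D u * iter i D v) *+ 'C(n, i).
Proof.
move=> DM n u v; elim: n => [|n IHn]; first by rewrite big_ord1.
rewrite iterS {}IHn raddf_sum.
under eq_bigr => i _.
  rewrite raddfMn /= DM mulrnDl -!iterS -subSn; last by rewrite -ltnS.
  over.
rewrite big_split /= [X in X + _]big_ord_recl [in RHS]big_ord_recl /= !bin0.
rewrite -addrA; congr (_ + _).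
under [in RHS]eq_bigr do rewrite /bump add1n binS mulrnDr subSS.
rewrite [in RHS]big_split /= [X in _ = X + _]big_ord_recr /=.
by rewrite bin_small // mulr0n addr0.
Qed.

Lemma iter_pchar_leibniz (S : comNzRingType) (p : nat) (D : {additive S -> S}) :
    p \in [pchar S] -> (forall u v, D (u * v) = D u * v + u * D v) ->
  forall u v, iter p D (u * v) = iter p D u * v + u * iter p D v.
Proof.
move=> charS DM u v; rewrite iter_leibniz //.
have := prime_gt0 (pcharf_prime charS); case: p charS => // q charS _.
rewrite big_ord_recl big_ord_recr /= /bump /= add1n subnn bin0 binn !mulr1n.
rewrite big1 ?add0r // => i _; have lt_iq := ltn_ord i.
by rewrite -mulr_natr bin_lt_pcharf_0 ?mulr0 // add1n ltnS lt_iq.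
Qed.

Lemma iter_morph (S T : Type) (pi : S -> T) (D : S -> S) (D' : T -> T) :
  {morph pi : x / D x >-> D' x} ->
  forall n, {morph pi : x / iter n D x >-> iter n D' x}.
Proof. by move=> piD; elim=> //= n IHn x; rewrite piD IHn. Qed.

(** * Vector fields on the affine line *)

Section PolyVectorFields.

Variable R : idomainType.
Implicit Types f g : {poly R}.

Local Notation vf f := (f \*o @deriv R).
Local Notation alt f := (fun g => (f * g)^`()).

Lemma iter_vf_alt f n g : iter n.+1 (vf f) g = f * iter n (alt f) g^`().
Proof. by elim: n => //= n <-. Qed.

Lemma vf_leibniz f g1 g2 : vf f (g1 * g2) = vf f g1 * g2 + g1 * vf f g2.
Proof. by rewrite /= derivM mulrDr mulrA [g1 * (f * _)]mulrCA. Qed.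

(** [vfcoef f n i] is the coefficient of the i-th derivative in the expansion of
    the n-th iterate of f d/dx; the recursion is f d/dx (a g^(i)) =
    f a' g^(i) + f a g^(i+1). *)
Fixpoint vfcoef f n i : {poly R} :=
  match n, i with
  | 0, 0 => 1
  | 0, _.+1 => 0
  | m.+1, 0 => f * (vfcoef f m 0)^`()
  | m.+1, j.+1 => f * ((vfcoef f m j.+1)^`() + vfcoef f m j)
  end.

Lemma vfcoef_gt f n i : (n < i)%N -> vfcoef f n i = 0.
Proof.
elim: n i => [|n IHn] [|i] //= lt_n_i.
by rewrite !IHn ?deriv0 ?addr0 ?mulr0 // ltnW.
Qed.

Lemma vfcoef_diag f n : vfcoef f n n = f ^+ n.
Proof.
by elim: n => //= n IHn; rewrite vfcoef_gt // deriv0 add0r IHn -exprS.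
Qed.

Lemma vfcoefS0 f n : vfcoef f n.+1 0 = 0.
Proof.
elim: n => [|n /= IHn] /=; first by rewrite -polyC1 derivC mulr0.
by rewrite IHn deriv0 mulr0.
Qed.

Lemma iter_vfE f n g :
  iter n (vf f) g = \sum_(i < n.+1) vfcoef f n i * g^`(i).
Proof.
elim: n => [|n IHn]; first by rewrite big_ord1 mul1r.
rewrite iterS {}IHn /= raddf_sum mulr_sumr.
under [LHS]eq_bigr do rewrite /= derivM mulrDr -derivnS.
rewrite big_split /= [X in X + _]big_ord_recl [in RHS]big_ord_recl -addrA !mulrA.
congr (_ + _); under [in RHS]eq_bigr do rewrite /= mulrDr mulrDl -!mulrA.
rewrite [in RHS]big_split /= [X in _ = X + _]big_ord_recr /= vfcoef_gt //.
by rewrite deriv0 mul0r mulr0 addr0.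
Qed.

Variables (p : nat) (charR : p \in [pchar R]).

Let p_prime : prime p := pcharf_prime charR.

Lemma natr_fact_neq0 n : (n < p)%N -> n`!%:R != 0 :> R.
Proof.
elim: n => [|n IHn] ltnp; first exact: oner_neq0.
rewrite factS natrM mulf_neq0 ?IHn ?(ltnW ltnp) //.
by rewrite -(dvdn_pcharf charR) gtnNdvd.
Qed.

(** Linear independence of the operators (d/dx)^i for i < p: at x^j the terms
    with i > j vanish, so that the c_j are found to be 0 one after the other. *)
Lemma diffop_eq0 n (c : nat -> {poly R}) : (n <= p)%N ->
    (forall j, (j < n)%N -> \sum_(i < n) c i * ('X^j)^`(i) = 0) ->
  forall j, (j < n)%N -> c j = 0.
Proof.
move=> le_np c0; elim/ltn_ind => j IHj ltjn.
move: (c0 j ltjn); rewrite (bigD1 (Ordinal ltjn)) //= big1 => [|i neq_ij].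
  rewrite addr0 derivnXn subnn ffactnn => /eqP; rewrite mulf_eq0 => /predU1P[//|].
  rewrite -polyC_natr polyC_eq0.
  by rewrite (negPf (natr_fact_neq0 _ (leq_trans ltjn le_np))).
have [lt_ij|lt_ji|eq_ij] := ltngtP i j; first by rewrite IHj ?mul0r.
  by rewrite derivn_poly0 ?mulr0 // size_polyXn.
by case/eqP: neq_ij; apply: val_inj.
Qed.

(** Composed with d/dx on the left, the operator with coefficients b_i becomes
    the operator with coefficients c_i = b_i' + b_(i-1); these are 0 by
    independence, so that b_0 = - b_1' = b_2'' and so on. *)
Lemma diffop_ker_coef0 n (b : nat -> {poly R}) : (n < p)%N ->
    (forall g, (\sum_(i < n.+1) b i * g^`(i))^`() = 0) ->
  b 0 = (-1) ^+ n * (b n)^`(n).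
Proof.
move=> lt_np b0.
pose c i := (b i)^`() + (if i is j.+1 then b j else 0).
have c0 : forall j, (j < n.+1)%N -> c j = 0.
  apply: diffop_eq0 => // j ltjn; rewrite -[RHS](b0 'X^j) raddf_sum.
  under [RHS]eq_bigr do rewrite /= derivM -derivnS.
  under [LHS]eq_bigr do rewrite mulrDl.
  rewrite !big_split /=; congr (_ + _); rewrite big_ord_recl mul0r add0r.
  (* the top term of the derivative, of order n+1, vanishes on x^j *)
  rewrite [RHS]big_ord_recr /= -derivnS [X in b n * X]derivn_poly0 ?size_polyXn //.
  by rewrite mulr0 addr0.
have bE m : (m <= n)%N -> b 0 = (-1) ^+ m * (b m)^`(m).
  elim: m => [|m IHm] lt_mn; first by rewrite mul1r.
  rewrite (IHm (ltnW lt_mn)); move/eqP: (c0 m.+1 lt_mn).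
  rewrite /c addrC addr_eq0 => /eqP->.
  by rewrite raddfN /= exprS mulN1r mulrN mulNr /derivn -iterSr.
exact: bE.
Qed.

(** The p-th iterate of f d/dx is a derivation, and so determined by its value
    f E at x. *)
Lemma iter_vf_pchar f g : iter p (vf f) g = f * iter p.-1 (alt f) 1 * g^`().
Proof.
have charX : p \in [pchar {poly R}] by rewrite pchar_poly.
have DM := iter_pchar_leibniz _ _ (vf f) charX (vf_leibniz f).
have DX : iter p (vf f) 'X = f * iter p.-1 (alt f) 1.
  by rewrite -{1}(prednK (prime_gt0 p_prime)) iter_vf_alt derivX.
have DC c : iter p (vf f) c%:P = 0.
  rewrite -(prednK (prime_gt0 p_prime)) iter_vf_alt derivC.
  by elim: p.-1 => [|n IHn]; rewrite ?mulr0 //= IHn deriv0 mulr0.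
have DD : {morph iter p (vf f) : u v / u + v}.
  move=> u v; elim: (p) => //= n ->; by rewrite derivD mulrDr.
elim/poly_ind: g => [|g c IHg]; first by rewrite -polyC0 DC derivC mulr0.
by rewrite DD DM DC IHg DX derivMXaddC addr0 mulrDr mulrA addrC [g * _]mulrC.
Qed.

Lemma deriv_iter_alt f : (iter p.-1 (alt f) 1)^`() = 0.
Proof.
have [->|f_neq0] := eqVneq f 0.
  have := prime_gt1 p_prime; case: (p) => [|[|q]] //= _.
  by rewrite mul0r !deriv0.
set E := iter _ _ _.
have: iter p (vf f) (vf f 'X) = vf f (iter p (vf f) 'X) by rewrite -iterSr.
rewrite !iter_vf_pchar -/E /= derivX !mulr1 derivM mulrDr -mulrA.
rewrite [E * _]mulrC => /eqP; rewrite -subr_eq0 opprD addrA subrr add0r oppr_eq0.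
by rewrite !mulf_eq0 (negPf f_neq0) => /eqP.
Qed.

(** The operator D^(p-1) - E of the argument for (c) has the coefficients [b i]
    below; its order p-1 is the largest one to which independence applies. *)
Lemma derivn_exp_alt f : (f ^+ p.-1)^`(p.-1) = - iter p.-1 (alt f) 1.
Proof.
set E := iter _ _ _; have p_gt1 := prime_gt1 p_prime.
have p1K : p = p.-2.+2 by move: p_gt1; case: (p) => [|[]].
have [f0|f_neq0] := eqVneq f 0.
  have -> : E = 0 by rewrite /E p1K /= f0 mul0r deriv0.
  have -> : f ^+ p.-1 = 0 by rewrite f0 p1K exprS mul0r.
  by rewrite oppr0 raddf0.
pose b i := vfcoef f p.-1 i - (if i is 0 then E else 0).
have phiE g : \sum_(i < p.-1.+1) b i * g^`(i) = iter p.-1 (vf f) g - E * g.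
  rewrite iter_vfE !big_ord_recl /b mulrBl derivn0 addrAC; congr (_ + _ - _).
  by apply: eq_bigr => i _; rewrite subr0.
have b0 : forall g, (\sum_(i < p.-1.+1) b i * g^`(i))^`() = 0.
  move=> g; rewrite phiE derivB derivM deriv_iter_alt mul0r add0r; apply/eqP.
  rewrite -(mulrI_eq0 _ (mulfI f_neq0)) mulrBr mulrA -iter_vf_pchar.
  by rewrite -{2}(prednK (prime_gt0 p_prime)) iterS subrr.
have := diffop_ker_coef0 p.-1 b _ b0; rewrite prednK ?prime_gt0 // => /(_ (leqnn _)).
have bE : b 0 = - E by rewrite /b p1K vfcoefS0 sub0r.
have -> : b p.-1 = f ^+ p.-1 by rewrite /b p1K /= -[RHS]vfcoef_diag subr0.
rewrite bE => ->.
have -> : (-1) ^+ p.-1 = 1 :> {poly R}; last by rewrite mul1r.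
(* (-1)^p = -1 by additivity of Frobenius, which covers p = 2 as well *)
have charX : p \in [pchar {poly R}] by rewrite pchar_poly.
apply: (@mulrI _ (-1)); first by rewrite unitrN1.
rewrite mulr1 -exprS prednK ?prime_gt0 //.
by have := pFrobenius_autN charX 1; rewrite !pFrobenius_autE expr1n.
Qed.

End PolyVectorFields.

(** * Reduction modulo h *)

Section Reduction.

Variables (p : nat) (F : fieldType) (charF : p \in [pchar F]).
Variables (h : {poly F}) (hE : h = 'X^p - 1 \/ h = 'X^p).
Local Notation A := {poly %/ h}.
Local Notation d := (ddx charF hE).

Lemma in_qpolyK (g : A) : in_qpoly h (g : {poly F}) = g.
Proof. by apply: val_inj; exact/in_qpoly_small/size_mk_monic. Qed.

Lemma size_modulus : size (mk_monic h) = p.+1.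
Proof.
rewrite (mk_monic_modulus charF hE); have p_gt0 := prime_gt0 (pcharf_prime charF).
by case: hE => ->; rewrite ?size_polyXn // -polyC1 size_XnsubC.
Qed.

Lemma in_qpolyC (c : F) : in_qpoly h c%:P = c%:A.
Proof. by rewrite -[c%:P]mulr1 mul_polyC in_qpolyZ in_qpoly1. Qed.

(** The derivative of a representative of degree < p is again reduced, so it
    vanishes as a polynomial, and i a_i = 0 forces a_i = 0 for 0 < i < p. *)
Lemma ddx_eq0_const (g : A) : d g = 0 -> g = ((g : {poly F})`_0)%:A.
Proof.
move=> dg0; have szg : (size (g : {poly F}) <= p)%N.
  by rewrite -ltnS -size_modulus size_mk_monic.
have g'0 : (g : {poly F})^`() = 0.
  have <- : (in_qpoly h (g : {poly F})^`() : {poly F}) = (g : {poly F})^`().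
    apply/in_qpoly_small/(@leq_ltn_trans p); last by rewrite size_modulus.
    exact: leq_trans (size_poly _ _) (leq_trans (leq_pred _) szg).
  by rewrite -(ddxE charF hE) in_qpolyK dg0.
rewrite -in_qpolyC -{1}[g]in_qpolyK; congr in_qpoly.
apply/polyP=> -[|i]; rewrite coefC //=.
have [lt_ip|le_pi] := ltnP i.+1 p; last first.
  by rewrite nth_default // (leq_trans szg).
have /eqP := congr1 (fun q : {poly F} => q`_i) g'0.
rewrite coef_deriv coef0 -mulr_natr mulf_eq0 -(dvdn_pcharf charF).
by rewrite gtnNdvd // orbF => /eqP.
Qed.

End Reduction.

Theorem theorem1 (p : nat) (p_prime : prime p) (F : fieldType)
    (charF : p \in [pchar F]) (h : {poly F})
    (hE : h = 'X^p - 1 \/ h = 'X^p) :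
  let d := ddx charF hE in
  exists C : {poly %/ h} -> F, forall f : {poly %/ h},
    [/\ Der_pmap charF (vfield f d) = C f *: vfield f d,
        iter p.-2 (fun g => d (f * g)) (d f) = (C f)%:A
      & iter p.-1 d (f ^+ p.-1) = (- C f)%:A].
Proof.
move=> d.
pose E (f : {poly %/ h}) : {poly F} :=
  iter p.-1 (fun g => ((f : {poly F}) * g)^`()) 1.
exists (fun f => (in_qpoly h (E f) : {poly F})`_0) => f; set c := _`_0.
have cE : in_qpoly h (E f) = c%:A.
  by apply: (ddx_eq0_const _ _ charF) => //; rewrite ddxE deriv_iter_alt // raddf0.
have altE : {morph in_qpoly h : g / (val f * g)^`() >-> d (f * g)}.
  by move=> g; rewrite -(ddxE charF hE) in_qpolyM in_qpolyK.
have vfE : {morph in_qpoly h : g / val f * g^`() >-> vfield f d g}.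
  by move=> g; rewrite vfieldE ddxE in_qpolyM in_qpolyK.
split.
- apply: val_inj; apply/lfunP=> g; rewrite [RHS]scale_lfunE Der_pmapE.
  rewrite -[g]in_qpolyK -(iter_morph _ _ _ _ _ vfE) iter_vf_pchar //.
  by rewrite -/(E f) mulrAC in_qpolyM -vfE cE mulr_algr.
- rewrite -cE /E; have := prime_gt1 p_prime; case: (p) => [|[|q]] // _.
  by rewrite iterSr (iter_morph _ _ _ _ _ altE) altE in_qpoly1 mulr1.
have dE : {morph in_qpoly h : g / g^`() >-> d g} by move=> g; rewrite ddxE.
rewrite scaleNr -cE -raddfN /E /= -derivn_exp_alt //.
by rewrite (iter_morph _ _ _ _ _ dE) rmorphXn /= in_qpolyK.
Qed.
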